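(* Let $N,M,K$ be positive integers with $K<N$, let $a\ge 0$, and let $u^{(1)},\dots,u^{(K)}\in\mathbb{R}^N$ be the current ensemble of the sampling error-corrected ensemble Kalman inversion (EKI) with forward model $G:\mathbb{R}^N\to\mathbb{R}^M$ and predictions $g^{(k)}=G(u^{(k)})$, $k=1,\dots,K$. For $1\le l\le N$ and $1\le m\le M$ let $r^{ug}_{lm}$ denote the sample correlation between $\{u^{(k)}_l\}_{k=1}^K$ and $\{g^{(k)}_m\}_{k=1}^K$. If, for each $m$, $r^{ug}_{lm}$ is independent of $l$ (i.e. $r^{ug}_{lm}=r^{ug}_{l'm}$ for all $l,l'\in\{1,\dots,N\}$), then the ensemble updated by one step of the sampling error-corrected EKI belongs to the linear span of the previous ensemble: for every $j=1,\dots,K$, $$u^{(j)}+C^{ug}_{sec}\left(C^{gg}_{sec}+\Gamma\right)^{-1}\left(y^{(j)}-g^{(j)}\right)\in \mathrm{span}\{u^{(1)},\dots,u^{(K)}\}.$$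
   Context: Setting. $G:\mathbb{R}^N\to\mathbb{R}^M$ is a (possibly nonlinear) map, $y\in\mathbb{R}^M$ is the measurement, and $\Gamma\in\mathbb{R}^{M\times M}$ is the (symmetric positive definite) covariance matrix of the measurement error. The perturbed measurements are $y^{(j)}=y+\zeta^{(j)}\in\mathbb{R}^M$, $j=1,\dots,K$, where $\zeta^{(j)}$ is a realization of a Gaussian vector with mean zero and covariance $\Gamma$; the claim is about each realization. Subscripts $l$, $m$ on vectors denote components. Sample means and covariances. With $\overline{u}=\frac1K\sum_{k=1}^K u^{(k)}$ and $\overline{g}=\frac1K\sum_{k=1}^K g^{(k)}$, $$C^{ug}=\frac1K\sum_{k=1}^K(u^{(k)}-\overline{u})(g^{(k)}-\overline{g})^{T}\in\mathbb{R}^{N\times M},\qquad C^{gg}=\frac1K\sum_{k=1}^K(g^{(k)}-\overline{g})(g^{(k)}-\overline{g})^{T}\in\mathbb{R}^{M\times M}.$$ Correlations. Let $V^u\in\mathbb{R}^{N\times N}$ and $V^g\in\mathbb{R}^{M\times M}$ be the diagonal matrices whose diagonal entries are the sample standard deviations (with normalization $\frac1K$) of the components of $\{u^{(k)}\}$ and of $\{g^{(k)}\}$, respectively; these are assumed to be nonzero so that the sample correlations are defined. The sample correlation matrices $R^{ug}=(r^{ug}_{lm})$ and $R^{gg}=(r^{gg}_{lm})$ are defined by $C^{ug}=V^uR^{ug}V^g$ and $C^{gg}=V^gR^{gg}V^g$. Sampling error correction with power $a\ge 0$. The corrected correlation matrices have entries $$(R^{ug}_{sec})_{lm}=|r^{ug}_{lm}|^{a}\,r^{ug}_{lm},\qquad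 (R^{gg}_{sec})_{lm}=|r^{gg}_{lm}|^{a}\,r^{gg}_{lm},$$ and the corrected covariance matrices are $C^{ug}_{sec}=V^uR^{ug}_{sec}V^g$ and $C^{gg}_{sec}=V^gR^{gg}_{sec}V^g$. It is assumed that $C^{gg}_{sec}+\Gamma$ is invertible, so that the update is defined. Update. One step of the sampling error-corrected EKI replaces each $u^{(j)}$ by $u^{(j)}+C^{ug}_{sec}(C^{gg}_{sec}+\Gamma)^{-1}(y^{(j)}-g^{(j)})$. *)

(* Defs.v *)
From mathcomp Require Import all_boot all_order all_algebra.
From mathcomp Require Import reals exp.

Set Implicit Arguments.
Unset Strict Implicit.
Unset Printing Implicit Defensive.

Import Order.TTheory GRing.Theory Num.Theory.

Local Open Scope ring_scope.

Definition sample_mean (R : realType) (K p : nat)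
    (X : 'I_K -> 'cV[R]_p) : 'cV[R]_p :=
  K%:R^-1 *: \sum_(k < K) X k.

Definition sample_cov (R : realType) (K p q : nat)
    (X : 'I_K -> 'cV[R]_p) (Y : 'I_K -> 'cV[R]_q) : 'M[R]_(p, q) :=
  K%:R^-1 *:
    \sum_(k < K) (X k - sample_mean X) *m (Y k - sample_mean Y)^T.

Definition sample_std (R : realType) (K p : nat)
    (X : 'I_K -> 'cV[R]_p) (l : 'I_p) : R :=
  Num.sqrt (K%:R^-1 * \sum_(k < K) (X k l 0 - sample_mean X l 0) ^+ 2).

Definition std_mx (R : realType) (K p : nat)
    (X : 'I_K -> 'cV[R]_p) : 'M[R]_p :=
  diag_mx (\row_l sample_std X l).

(* The solution C of the defining equation
   [sample_cov X Y = std_mx X *m C *m std_mx Y]; it is meaningful when all the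
   standard deviations are nonzero, see [sample_corr_unique] below. *)
Definition sample_corr (R : realType) (K p q : nat)
    (X : 'I_K -> 'cV[R]_p) (Y : 'I_K -> 'cV[R]_q) : 'M[R]_(p, q) :=
  invmx (std_mx X) *m sample_cov X Y *m invmx (std_mx Y).

(* [powR] satisfies [0 `^ 0 = 1], so a null correlation is always sent to 0
   and [a = 0] is the absence of correction. *)
Definition sec_corr (R : realType) (K p q : nat) (a : R)
    (X : 'I_K -> 'cV[R]_p) (Y : 'I_K -> 'cV[R]_q) : 'M[R]_(p, q) :=
  map_mx (fun r => `|r| `^ a * r) (sample_corr X Y).

Definition sec_cov (R : realType) (K p q : nat) (a : R)
    (X : 'I_K -> 'cV[R]_p) (Y : 'I_K -> 'cV[R]_q) : 'M[R]_(p, q) :=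
  std_mx X *m sec_corr a X Y *m std_mx Y.

Definition sym_posdef (R : realType) (p : nat) (A : 'M[R]_p) : Prop :=
  A^T = A /\ forall v : 'cV[R]_p, v != 0 -> 0 < (v^T *m A *m v) 0 0.

Lemma std_mx_unit (R : realType) (K p : nat) (X : 'I_K -> 'cV[R]_p) :
  (forall l, sample_std X l != 0) -> std_mx X \in unitmx.
Proof.
move=> sX; rewrite unitmxE det_diag unitfE.
by apply/prodf_neq0 => l _; rewrite mxE.
Qed.

Lemma sample_corr_unique (R : realType) (K p q : nat)
    (X : 'I_K -> 'cV[R]_p) (Y : 'I_K -> 'cV[R]_q) (C : 'M[R]_(p, q)) :
    (forall l, sample_std X l != 0) -> (forall m, sample_std Y m != 0) ->
  sample_cov X Y = std_mx X *m C *m std_mx Y <-> C = sample_corr X Y.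
Proof.
move=> /std_mx_unit uX /std_mx_unit uY; rewrite /sample_corr; split=> [->|->].
  by rewrite mulmxA mulKmx // mulmxK.
by rewrite !mulmxA mulmxV // mul1mx mulmxKV.
Qed.

(* Main.v *)
(** When each column of [r^ug] is constant, with value [r_m] in column [m], the
entrywise correction [r |-> |r|^a r] is right multiplication by the diagonal
matrix of the [|r_m|^a]. It commutes with [V^g], so [C^ug_sec] is [C^ug] times a
diagonal matrix, and the columns of [C^ug] lie in the span of the ensemble. *)
Require Import Defs.
From mathcomp Require Import all_boot all_order all_algebra.
From mathcomp Require Import reals exp.
Import Order.TTheory GRing.Theory Num.Theory.
Local Open Scope ring_scope.

Lemma sample_mean_span (R : realType) (K p : nat) (X : 'I_K -> 'cV[R]_p) :
  sample_mean X \in <<[seq X k | k : 'I_K]>>%VS.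
Proof.
by apply/memvZ/memv_suml => k _; apply/memv_span/image_f.
Qed.

(** Each summand is a column times a row, so applied to [v] it becomes a scalar multiple of the
    deviation [X k - sample_mean X]. *)
Lemma sample_cov_mul_span (R : realType) (K p q : nat)
    (X : 'I_K -> 'cV[R]_p) (Y : 'I_K -> 'cV[R]_q) (v : 'cV[R]_q) :
  sample_cov X Y *m v \in <<[seq X k | k : 'I_K]>>%VS.
Proof.
rewrite -scalemxAl mulmx_suml; apply/memvZ/memv_suml => k _.
rewrite -mulmxA [_ *m v]mx11_scalar mul_mx_scalar memvZ //.
by rewrite memvB ?sample_mean_span //; apply/memv_span/image_f.
Qed.

Lemma sec_cov_diag {R : realType} {K p q : nat} (a : R)
    {X : 'I_K -> 'cV[R]_p} {Y : 'I_K -> 'cV[R]_q} {r : 'rV[R]_q} :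
    (forall l, sample_std X l != 0) -> (forall m, sample_std Y m != 0) ->
    (forall l m, sample_corr X Y l m = r 0 m) ->
  sec_cov a X Y = sample_cov X Y *m diag_mx (\row_m `|r 0 m| `^ a).
Proof.
move=> sX sY corrE.
(* Factoring the covariance on the right through the correlation matrix leaves only the correlations
   to compare. *)
have -> := (sample_corr_unique (sample_corr X Y) sX sY).2 erefl.
have secE : sec_corr a X Y =
    sample_corr X Y *m diag_mx (\row_m `|r 0 m| `^ a).
  apply/matrixP => l m; rewrite mul_mx_diag [LHS]mxE [RHS]mxE corrE.
  by rewrite [(\row__ _) 0 m]mxE mulrC.
by rewrite /sec_cov secE -!mulmxA [diag_mx _ *m std_mx Y]diag_mxC.
Qed.

Theorem theorem1 (R : realType) (N M K : nat)
    (N_gt0 : (0 < N)%N) (M_gt0 : (0 < M)%N) (K_gt0 : (0 < K)%N)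
    (K_lt_N : (K < N)%N)
    (a : R) (a_ge0 : 0 <= a)
    (G : 'cV[R]_N -> 'cV[R]_M)
    (y : 'cV[R]_M) (zeta : 'I_K -> 'cV[R]_M)
    (Gamma : 'M[R]_M) (Gamma_spd : sym_posdef Gamma)
    (u : 'I_K -> 'cV[R]_N) (g : 'I_K -> 'cV[R]_M)
    (gE : forall k, g k = G (u k))
    (std_u_neq0 : forall l, sample_std u l != 0)
    (std_g_neq0 : forall m, sample_std g m != 0)
    (Cgg_unit : sec_cov a g g + Gamma \in unitmx)
    (corr_indep : forall (m : 'I_M) (l l' : 'I_N),
       sample_corr u g l m = sample_corr u g l' m) :
  forall j : 'I_K,
    u j + sec_cov a u g *m invmx (sec_cov a g g + Gamma)
            *m ((y + zeta j) - g j)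
      \in <<[seq u k | k : 'I_K]>>%VS.
Proof.
(* All rows of the correlation matrix agree; the first one, available since [0 < N], serves as the
   common row. *)
move=> j; pose r := row (Ordinal N_gt0) (sample_corr u g).
have corrE l m : sample_corr u g l m = r 0 m by rewrite [r 0 m]mxE.
(* Reassociated to the right, the increment is [sample_cov u g] applied to a single vector. *)
rewrite (sec_cov_diag a std_u_neq0 std_g_neq0 corrE) -!mulmxA.
by rewrite memvD ?sample_cov_mul_span //; apply/memv_span/image_f.
Qed.
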